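(* There exists a resource contribution game $G$ with endowments as bags of atomic resources (RCGBAR) that admits no pure Nash equilibrium in presence of contention-tolerant preferences, i.e. $\mathsf{NE}^{\mathsf{ct}}(G)=\emptyset$.
   Context: Resources. Let $Res$ be a set of atomic resource types (which may be chosen freely). A resource bundle is a finite multiset over $Res$; $A_1\bullet\cdots\bullet A_k$ is the bundle consisting of the instances $A_1,\dots,A_k$. For a bundle $B$, $\flat(B)$ is its multiset of atomic resource instances. A resource bag is a finite multiset of resource bundles; for a bag $X=\{B_1,\dots,B_k\}$, $\flat^\bullet(X)=\flat(B_1)\uplus\dots\uplus\flat(B_k)$ (multiset sum). A bag $X$ can be transformed into a bundle $B$, written $X\rightsquigarrow B$, iff $\flat(B)\subseteq\flat^\bullet(X)$ (multiset inclusion). Games. A resource contribution game (RCG) is $G=(N,\gamma_1,\dots,\gamma_n,\epsilon_1,\dots,\epsilon_n)$ with $N=\{1,\dots,n\}$ a finite set of players, $\gamma_i$ a resource bundle (goal of $i$), $\epsilon_i$ a finite resource bag (endowment of $i$). It is an RCGBAR iff for every $i\in N$ every element of $\epsilon_i$ is an atomic resource (a bundle consisting of a single instance of an element of $Res$). The choices of $i$ are $\mathsf{ch}_i(G)=\{C\mid C\subseteq\epsilon_i\}$ (sub-multisets), the profiles are $\mathsf{ch}(G)=\prod_{i\in N}\mathsf{ch}_i(G)$, and the outcome of $P=(P_1,\dots,P_n)$ is the bag $\mathsf{out}(P)=P_1\uplus\dots\uplus P_n$. $(P_{-i},P_i')$ is $P$ with $P_i$ replaced by $P'_i$. Preferences.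 $P$ is good for $i$ according to contention-tolerant preferences $\mathsf{ct}$ iff $i$ is potentially satisfied in $P$, i.e. $\mathsf{out}(P)\rightsquigarrow\gamma_i$. Player $i$ strictly prefers $P$ over $Q$ (written $Q\prec_i^{\mathsf{ct}}P$) iff one of: (1) neither $P$ nor $Q$ is good for $i$ and $P_i\subset Q_i$ (strict multiset inclusion); (2) $P$ is good for $i$ and $Q$ is not; (3) both are good for $i$ and $P_i\subset Q_i$. $P$ is a (pure) Nash equilibrium according to $\mathsf{ct}$ iff there are no $i\in N$ and $P'_i\in\mathsf{ch}_i(G)$ with $P\prec_i^{\mathsf{ct}}(P_{-i},P'_i)$; $\mathsf{NE}^{\mathsf{ct}}(G)$ is the set of these. *)

(* Defs.v *)
From mathcomp Require Import all_boot finmap multiset.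

Set Implicit Arguments.
Unset Strict Implicit.
Unset Printing Implicit Defensive.

Local Open Scope mset_scope.

(* A bundle is its own multiset of atomic resource instances. *)
Definition bundle (Res : choiceType) := {mset Res}.
Definition bag (Res : choiceType) := {mset {mset Res}}.

(* The sum ranges over the elements of X counted with multiplicity. *)
Definition flat_bag (Res : choiceType) (X : bag Res) : {mset Res} :=
  \big[@msetD Res/mset0]_(B <- enum_mset X) B.

Definition transforms (Res : choiceType) (X : bag Res) (B : bundle Res) : bool :=
  B `<=` flat_bag X.

Record rcg (Res : choiceType) := RCG {
  nplayers : nat;
  goal : 'I_nplayers -> bundle Res;
  endowment : 'I_nplayers -> bag Res
}.

Definition is_atomic (Res : choiceType) (B : bundle Res) : Prop :=
  exists r : Res, B = [mset r].

Definition is_rcgbar (Res : choiceType) (G : rcg Res) : Prop :=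
  forall (i : 'I_(nplayers G)) (B : bundle Res),
    B \in enum_mset (endowment i) -> is_atomic B.

Definition is_choice (Res : choiceType) (G : rcg Res) (i : 'I_(nplayers G))
    (C : bag Res) : bool :=
  C `<=` endowment i.

(* One bag per player, not necessarily drawn from the endowments; the elements
   of ch(G) are the families satisfying is_profile. *)
Definition bags (Res : choiceType) (G : rcg Res) :=
  {ffun 'I_(nplayers G) -> {mset {mset Res}}}.

Definition is_profile (Res : choiceType) (G : rcg Res) (P : bags G) : Prop :=
  forall i : 'I_(nplayers G), is_choice i (P i).

Definition out (Res : choiceType) (G : rcg Res) (P : bags G) : bag Res :=
  \big[@msetD {mset Res}/mset0]_(i < nplayers G) P i.

Definition deviate (Res : choiceType) (G : rcg Res) (P : bags G)
    (i : 'I_(nplayers G)) (C : bag Res) : bags G :=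
  [ffun j => if j == i then C else P j].

Definition good_ct (Res : choiceType) (G : rcg Res) (i : 'I_(nplayers G))
    (P : bags G) : bool :=
  transforms (out P) (goal i).

(* prec_ct i Q P: player i strictly prefers P over Q. *)
Definition prec_ct (Res : choiceType) (G : rcg Res) (i : 'I_(nplayers G))
    (Q P : bags G) : bool :=
  [|| [&& ~~ good_ct i P, ~~ good_ct i Q & P i `<` Q i],
      good_ct i P && ~~ good_ct i Q
    | [&& good_ct i P, good_ct i Q & P i `<` Q i]].

Definition NE_ct (Res : choiceType) (G : rcg Res) (P : bags G) : Prop :=
  is_profile P /\
  ~ exists (i : 'I_(nplayers G)) (C : bag Res),
      is_choice i C /\ prec_ct i P (deviate P i C).

(* Main.v *)
(* One resource type, two players owning one unit each; player 0 needs two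
   units, player 1 needs one. Player 0 contributes exactly when player 1 does,
   whereas player 1 contributes exactly when player 0 does not (otherwise
   player 1 free-rides), so best responses cycle. *)
Require Import Defs.
From mathcomp Require Import all_boot finmap multiset.

Local Open Scope mset_scope.

Lemma msetn_msubset (K : choiceType) (a : K) (m n : nat) :
  (msetn m a `<=` msetn n a) = (m <= n).
Proof.
apply/msubsetP/idP => [/(_ a)|le_mn x]; first by rewrite !msetnxx.
by rewrite !msetnE; case: ifP.
Qed.

Lemma msetn_mproper (K : choiceType) (a : K) (m n : nat) :
  (msetn m a `<` msetn n a) = (m < n).
Proof. by rewrite mproperE !msetn_msubset -ltnNge andb_idl // => /ltnW. Qed.

(** This is what reduces a choice to a number: endowments have a single kind of element, so only its
    multiplicity is left to choose. *)
Lemma msubset_msetnE (K : choiceType) (a : K) (n : nat) (A : {mset K}) :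
  A `<=` msetn n a -> A = msetn (A a) a.
Proof.
move=> /msubsetP sA; apply/msetP => x; rewrite msetnE.
by case: eqP => [->//|/eqP xa]; apply/eqP; have:= sA x; rewrite msetnE (negbTE xa) leqn0.
Qed.

Lemma msetnD (K : choiceType) (a : K) (m n : nat) :
  msetn m a `+` msetn n a = msetn (m + n) a.
Proof. by apply/msetP => x; rewrite msetE2 !msetnE; case: ifP. Qed.

Lemma flat_bag_units (Res : choiceType) (r : Res) (n : nat) :
  flat_bag (msetn n [mset r]) = msetn n r.
Proof.
rewrite /flat_bag enum_msetn; elim: n => [|n IHn] /=.
  by rewrite big_nil msetn0.
by rewrite big_cons IHn msetnD.
Qed.

Lemma deviate_profile (Res : choiceType) (G : rcg Res) (P : bags G)
    (i : 'I_(nplayers G)) (C : bag Res) :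
  is_profile P -> is_choice i C -> is_profile (deviate P i C).
Proof. by move=> chP chC j; rewrite /deviate ffunE; case: eqP => [->|_]. Qed.

Definition free_rider_need (i : 'I_2) : nat := if i == ord0 then 2 else 1.

Definition free_rider_game : rcg unit :=
  @RCG unit 2 (fun i => msetn (free_rider_need i) tt) (fun=> [mset [mset tt]]).

Local Notation player := 'I_(nplayers free_rider_game).

Definition units_given (P : bags free_rider_game) (i : player) : nat :=
  P i [mset tt].

Lemma profileE (P : bags free_rider_game) (i : player) :
  is_profile P -> P i = msetn (units_given P i) [mset tt].
Proof. by move=> /(_ i); apply: msubset_msetnE. Qed.

Lemma units_given_le1 (P : bags free_rider_game) (i : player) :
  is_profile P -> units_given P i <= 1.
Proof. by move=> /(_ i)/msubsetP/(_ [mset tt]); rewrite msetnxx. Qed.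

(** With one resource type, flattening the outcome merely counts units. In ['I_2], [rev_ord i] is
    the opponent of [i]. *)
Lemma good_ctE (P : bags free_rider_game) (i : player) :
  is_profile P ->
  good_ct i P =
  (free_rider_need i <= units_given P i + units_given P (rev_ord i)).
Proof.
move=> chP; rewrite /good_ct /transforms /out /= 2!big_ord_recl big_ord0 msetD0.
rewrite !(profileE _ _ chP) msetnD flat_bag_units msetn_msubset; congr leq.
(* The outcome lists player 0 first, so the sum is swapped when [i] is player 1. *)
case: i => [[|[|//]]] lti; last rewrite addnC; congr (_ + _);
  by congr units_given; apply: val_inj.
Qed.

(** The negated formula is [prec_ct] for the deviation to [n] units, rewritten in counts so that
    concrete values decide it by computation. *)
Lemma NE_ct_stable (P : bags free_rider_game) (i : player) (n : nat) :
    NE_ct P -> n <= 1 ->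
  let other := units_given P (rev_ord i) in
  let old := free_rider_need i <= units_given P i + other in
  let new := free_rider_need i <= n + other in
  ~~ [|| [&& ~~ new, ~~ old & n < units_given P i],
         new && ~~ old
       | [&& new, old & n < units_given P i]].
Proof.
case=> chP stable le_n1 /=; apply/negP => improves; apply: stable.
have chn : is_choice i (msetn n [mset tt]) by rewrite /is_choice msetn_msubset.
exists i, (msetn n [mset tt]); split=> //.
have chQ := deviate_profile _ _ _ _ _ chP chn.
rewrite /prec_ct !good_ctE // (profileE _ _ chP) (profileE _ _ chQ) msetn_mproper.
rewrite /units_given !ffunE eqxx msetnxx.
(* The opponent's bag is unchanged, as [rev_ord] has no fixed point on two players. *)
by rewrite (_ : (rev_ord i == i) = false) //; case: (i) => [[|[|]]].
Qed.

Lemma free_rider_game_no_NE (P : bags free_rider_game) : ~ NE_ct P.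
Proof.
move=> neP; have [chP _] := neP.
have rev0 : rev_ord ord0 = ord_max :> player by apply: val_inj.
have rev1 : rev_ord ord_max = ord0 :> player by apply: val_inj.
have := (units_given_le1 _ ord0 chP, units_given_le1 _ ord_max chP).
have := (NE_ct_stable _ ord0 0 neP isT, NE_ct_stable _ ord0 1 neP isT,
         NE_ct_stable _ ord_max 0 neP isT, NE_ct_stable _ ord_max 1 neP isT).
rewrite /= rev0 rev1.
(* Counts above 1 break the bounds. Profitable deviations: at (0,0) player 1 gives, at (0,1) player
   0 gives, at (1,1) player 1 withdraws, at (1,0) player 0 withdraws. *)
case: (units_given P ord0) (units_given P ord_max) => [|[|x]] [|[|y]];
  by move=> [[[? ?] ?] ?] [? ?].
Qed.

Theorem proposition5 :
  exists (Res : choiceType) (G : rcg Res),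
    is_rcgbar G /\ (forall P : bags G, ~ NE_ct P).
Proof.
exists unit, free_rider_game; split; last exact: free_rider_game_no_NE.
by move=> i B; rewrite enum_msetn inE => /eqP->; exists tt.
Qed.
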